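(* Let $F$ and $L$ be complete valued fields such that $L$ is a finite extension of $F$ as a valued field. Let $X$ be a nonempty compact Hausdorff space, totally disconnected if $F$ is non-Archimedean, let $g\in\mathrm{Gal}(L/F)$, and let $\tau:X\to X$ be a continuous map of finite order with $\mathrm{ord}(\tau)\mid\mathrm{ord}(g)$. Then the basic ${}^{L}/_{L^{g}}$ function algebra $$C(X,\tau,g):=\{f\in C_{L}(X): f(\tau(x))=g(f(x))\text{ for all }x\in X\}$$ is an ${}^{L}/_{L^{g}}$ uniform algebra.
   Context: A valuation on a field $F$ is a multiplicative norm $|\cdot|_{F}:F\to\mathbb{R}$; $F$ with a valuation is a valued field, complete if complete in the induced metric, non-Archimedean if $|a-b|_F\le\max(|a|_F,|b|_F)$ for all $a,b\in F$, else Archimedean. $L$ extends $F$ as a valued field if $F$ is a subfield of $L$ and $|\cdot|_L$ restricts to $|\cdot|_F$. $\mathrm{Gal}(L/F)$ is the group of automorphisms of $L$ fixing $F$ pointwise; $L^{g}:=\{x\in L:g(x)=x\}$. For a self-map $h$ of finite order, $\mathrm{ord}(h)$ is the least $n\ge1$ with $h^{(n)}=\mathrm{id}$, where $h^{(n)}$ denotes the $n$-fold composite. $C_L(X)$ is the unital Banach $L$-algebra of continuous $L$-valued functions on $X$ with pointwise operations and the sup norm $\|f\|_\infty=\sup_{x\in X}|f(x)|_L$. For a complete valued field $K$ such that $L$ is an extension of $K$ as a valued field, a subset $A\subseteq C_L(X)$ is an ${}^{L}/_{K}$ uniform algebra if: (i) $A$ is a $K$-algebra under pointwise operations; (ii)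 $A$ is complete with respect to $\|\cdot\|_\infty$; (iii) $K\subseteq A$ (as constant functions); (iv) $A$ separates the points of $X$, i.e. for all $x_1\neq x_2$ in $X$ there is $f\in A$ with $f(x_1)\ne f(x_2)$. Here $K=L^{g}$ with the restricted valuation (a complete valued field). *)

(* Defs.v *)
From HB Require Import structures.
From mathcomp Require Import all_boot all_order all_algebra all_field.
From mathcomp Require Import all_classical all_reals all_analysis.

Set Implicit Arguments.
Unset Strict Implicit.
Unset Printing Implicit Defensive.

Import Order.TTheory GRing.Theory Num.Theory.

Local Open Scope classical_set_scope.
Local Open Scope ring_scope.

Record valuation (R : realType) (F : fieldType) := Valuation {
  valuation_fun :> F -> R;
  valuation_ge0 : forall a, 0 <= valuation_fun a;
  valuation_eq0 : forall a, valuation_fun a = 0 <-> a = 0;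
  valuationM : forall a b,
    valuation_fun (a * b) = valuation_fun a * valuation_fun b;
  valuationD : forall a b,
    valuation_fun (a + b) <= valuation_fun a + valuation_fun b }.

Definition non_archimedean (R : realType) (F : fieldType)
    (v : valuation R F) : Prop :=
  forall a b, v (a - b) <= Num.max (v a) (v b).

Definition vdist (R : realType) (F : fieldType) (v : valuation R F)
  (a b : F) : R := v (a - b).

(* The field [F] as a metric space for the distance induced by [v]. The alias
   carries the topology, so that one field may bear several valuations. *)
Definition valued (R : realType) (F : fieldType) (v : valuation R F) : Type :=
  F.

Section valued_metric.
Context (R : realType) (F : fieldType) (v : valuation R F).

Let vdistxx a : vdist v a a = 0.
Proof. by rewrite /vdist subrr; apply/valuation_eq0. Qed.

Let vdist_positivity a b : vdist v a b = 0 -> a = b.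
Proof. by move=> /valuation_eq0/eqP; rewrite subr_eq0 => /eqP. Qed.

Let valuationN a : v (- a) = v a.
Proof.
apply/eqP; rewrite -(@eqrXn2 _ 2) ?valuation_ge0//.
by rewrite !expr2 -!valuationM mulrNN.
Qed.

Let vdistC a b : vdist v a b = vdist v b a.
Proof. by rewrite /vdist -valuationN opprB. Qed.

Let vdist_triangle b a c : vdist v a c <= vdist v a b + vdist v b c.
Proof. by rewrite /vdist -(subrKA b a) valuationD. Qed.

HB.instance Definition _ := Choice.copy (valued v) F.
HB.instance Definition _ := @isMetric.Build R (valued v)
  (vdist v) vdistxx vdist_positivity vdistC vdist_triangle.

End valued_metric.

Definition complete_for (R : realType) (T : Type) (d : T -> T -> R)
    (A : set T) : Prop :=
  forall u : nat -> T, (forall n, A (u n)) ->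
    (forall e : R, 0 < e -> exists N : nat, forall m n : nat,
       (N <= m)%N -> (N <= n)%N -> d (u m) (u n) < e) ->
    exists2 l, A l & forall e : R, 0 < e -> exists N : nat, forall n : nat,
       (N <= n)%N -> d (u n) l < e.

Definition complete_valuation (R : realType) (F : fieldType)
  (v : valuation R F) : Prop := complete_for (vdist v) [set: F].

Definition complete_valued_subfield (R : realType) (L : fieldType)
    (v : valuation R L) (K : set L) : Prop :=
  divring_closed (mem K) /\ complete_for (vdist v) K.

Definition CL (R : realType) (L : fieldType) (v : valuation R L)
    (X : topologicalType) : set (X -> L) :=
  [set f | continuous (f : X -> valued v)].

Definition supnorm (R : realType) (L : fieldType) (v : valuation R L)
  (X : Type) (f : X -> L) : R := sup (range (fun x => v (f x))).

Definition supdist (R : realType) (L : fieldType) (v : valuation R L)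
  (X : Type) (f h : X -> L) : R := supnorm v (fun x => f x - h x).

(* Closure under opposite is scaling by -1, as [K] will be a subfield. *)
Definition is_pointwise_algebra (L : fieldType) (X : Type) (K : set L)
    (A : set (X -> L)) : Prop :=
  [/\ A (fun=> 0),
      forall f h, A f -> A h -> A (fun x => f x + h x),
      forall f h, A f -> A h -> A (fun x => f x * h x)
    & forall k f, K k -> A f -> A (fun x => k * f x)].

(* That [K] is a complete valued subfield and that [A] consists of continuous
   functions is presupposed by the notion, and so is part of it here. *)
Record uniform_algebra (R : realType) (L : fieldType) (v : valuation R L)
    (X : topologicalType) (K : set L) (A : set (X -> L)) : Prop :=
  UniformAlgebra {
    ua_field : complete_valued_subfield v K;
    ua_continuous : A `<=` CL v (X := X);
    ua_algebra : is_pointwise_algebra K A;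
    ua_complete : complete_for (supdist v (X := X)) A;
    ua_const : forall k, K k -> A (fun=> k);
    ua_separates : forall x1 x2 : X, x1 <> x2 -> exists2 f, A f & f x1 <> f x2 }.

Definition finite_order (T : Type) (h : T -> T) : Prop :=
  exists n : nat, (0 < n)%N && `[< iter n h =1 id >].

(* The junk value is 0 when [h] has infinite order. *)
Definition ord (T : Type) (h : T -> T) : nat :=
  if pselect (finite_order h) is left e then ex_minn e else 0%N.

Definition basic_algebra (R : realType) (L : fieldType) (v : valuation R L)
    (X : topologicalType) (tau : X -> X) (g : L -> L) : set (X -> L) :=
  [set f | CL v f /\ forall x, f (tau x) = g (f x)].

(* Main.v *)
Require Import Defs.
From HB Require Import structures.
From mathcomp Require Import all_boot all_order all_algebra all_field.
From mathcomp Require Import all_classical all_reals all_analysis.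
From mathcomp Require Import ring lra zify.

Set Implicit Arguments.
Unset Strict Implicit.

Import Order.TTheory GRing.Theory Num.Theory.

Local Open Scope classical_set_scope.
Local Open Scope ring_scope.

(** Write [C(X, tau, g)] for the basic algebra and [N] for the order of [g].

The algebraic conditions and completeness need one analytic fact: [g] is an
isometry.  Since [L] is a finite-dimensional normed space over the complete
field [F], every linear endomorphism of [L] is bounded ([linear_bounded]), say
[vL (g x) <= C * vL x]; applying this to the powers of [x] improves [C] to 1,
and the inverse of [x] gives the reverse inequality
([automorphism_isometry]).  Hence [g] is continuous, the field fixed by [g] is
closed in [L], and the equation [f (tau x) = g (f x)] passes to uniform limits.

For separation, averaging any continuous [h : X -> L] as
[x |-> \sum_(j < N) g^j (h (tau^(N - j) x))] gives an element of
[C(X, tau, g)], because [ord tau] divides [N] ([equivariant_sum_basic]).  Given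
[x1 != x2], take [h] with [h x1 = 1] and [h = 0] at all other points of the
orbits of [x1] and [x2].  If the averages of [a * h] agreed at [x1] and [x2] for
all [a] in [L], there would be a linear relation between [g^0, ..., g^(N-1)] in
which [g^0] has coefficient 1, against Dedekind's independence of
multiplicative maps ([basic_algebra_separates]).  The same independence shows
that [g] has finite order, so that [N > 0].

It remains to separate two points of [X] by a continuous function with values
0 and 1 ([CL_separates_points]).  If [X] is totally disconnected it has enough
clopen sets and indicator functions do.  Otherwise [F] is Archimedean, which
forces [vL 2 > 1] ([non_archimedean_of_le1]); binary expansions then converge
in [L] and define a continuous map from the real line to [L] sending 0 to 0 and
1 to 1 ([nonconstant_path]), to be composed with a Urysohn function.  This takes
the place of Ostrowski's theorem. *)

(** * Endomorphisms of field extensions *)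

(** Dedekind's independence of characters.  Subtracting [chi_n y] times the
relation at [x] from the relation at [y * x] removes the last map; choosing [y]
where [chi_j] and [chi_n] differ, induction kills the coefficient of [chi_j]. *)
Lemma multiplicative_maps_free (L : fieldType) n (chi : 'I_n -> L -> L) :
  (forall i, chi i 1 = 1) -> (forall i, {morph chi i : x y / x * y}) ->
  (forall i j, chi i =1 chi j -> i = j) ->
  forall c : 'I_n -> L, (forall x, \sum_i c i * chi i x = 0) ->
  forall i, c i = 0.
Proof.
elim: n chi => [|n IH] chi chi1 chiM chi_inj c c0 i; first by case: i.
have c0' (j : 'I_n) : c (widen_ord (leqnSn n) j) = 0.
  set w := widen_ord (leqnSn n).
  have [y yP] : exists y, chi (w j) y != chi ord_max y.
    apply: contrapT => H; have /(congr1 val) : w j = ord_max.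
      apply: chi_inj => y; apply: contrapT => /eqP ny.
      by apply: H; exists y.
    by move=> /= jn; have := ltn_ord j; rewrite jn ltnn.
  have H : forall k, c (w k) * (chi (w k) y - chi ord_max y) = 0; last first.
    by have /eqP := H j; rewrite mulf_eq0 subr_eq0 (negPf yP) orbF => /eqP.
  apply: (IH (fun k => chi (w k))) => // [k l /chi_inj /(congr1 val) /= /val_inj//|].
  move=> x; have := c0 (y * x); have := c0 x; rewrite !big_ord_recr/= => cx cyx.
  transitivity ((\sum_(i < n) c (w i) * chi (w i) (y * x) +
      c ord_max * chi ord_max (y * x)) -
      chi ord_max y * (\sum_(i < n) c (w i) * chi (w i) x +
      c ord_max * chi ord_max x)); last by rewrite cyx cx mulr0 subr0.
  rewrite chiM mulrDr opprD addrACA [X in _ + X](_ : _ = 0) ?addr0;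
    last by ring.
  rewrite mulr_sumr -sumrB; apply: eq_bigr => k _; rewrite chiM; ring.
have [j ->|ni] := unliftP ord_max i.
  suff -> : lift ord_max j = widen_ord (leqnSn n) j by [].
  by apply: val_inj; rewrite /= /bump leqNgt ltn_ord.
have := c0 1; rewrite big_ord_recr/= big1 => [|k _]; last by rewrite c0' mul0r.
by rewrite add0r chi1 mulr1 ni.
Qed.

Section order.
Context (T : Type) (h : T -> T).
Hypothesis h_finite : finite_order h.

Lemma ord_gt0 : (0 < ord h)%N.
Proof.
by rewrite /ord; case: pselect => // f; case: ex_minnP => n /andP[].
Qed.

Lemma iter_ord x : iter (ord h) h x = x.
Proof.
rewrite /ord; case: pselect => // f.
by case: ex_minnP => n /andP[_ /asboolP]/(_ x).
Qed.

Lemma ord_le n : (0 < n)%N -> (forall x, iter n h x = x) -> (ord h <= n)%N.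
Proof.
move=> n0 hn; rewrite /ord; case: pselect => // f.
by case: ex_minnP => m _; apply; rewrite n0; exact/asboolP.
Qed.

End order.

Section field_endomorphism.
Context (F : fieldType) (L : fieldExtType F) (g : 'End(L)).
Hypothesis g1 : g 1 = 1.
Hypothesis gM : {morph g : x y / x * y}.

Lemma endomorphism_inj : injective g.
Proof.
move=> x y /eqP; rewrite -subr_eq0 -linearB => /eqP gxy.
apply/eqP; rewrite -subr_eq0; apply/negPn/negP => xy0.
by have := oner_neq0 L; rewrite -g1 -(divff xy0) gM gxy mul0r eqxx.
Qed.

Lemma endomorphismX x n : g (x ^+ n) = g x ^+ n.
Proof. by elim: n => [|n IH]; rewrite ?expr0// !exprS gM IH. Qed.

Lemma endomorphismV x : g x^-1 = (g x)^-1.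
Proof.
have [->|x0] := eqVneq x 0; first by rewrite linear0 !invr0 linear0.
have gx0 : g x != 0.
  by rewrite -(linear0 g); apply: contra_neq x0 => /endomorphism_inj.
by apply: (mulfI gx0); rewrite -gM !divff.
Qed.

Lemma iter_sumZ i n (a : 'I_n -> F) (e : 'I_n -> L) :
  iter i g (\sum_j a j *: e j) = \sum_j a j *: iter i g (e j).
Proof.
elim: i => //= i ->; rewrite linear_sum; apply: eq_bigr => j _.
exact: linearZ.
Qed.

Lemma iter_morph1 i : iter i g 1 = 1.
Proof. by elim: i => //= i ->. Qed.

Lemma iter_morphM i : {morph iter i g : x y / x * y}.
Proof. by move=> x y; elim: i => //= i ->. Qed.

Lemma iter_injective i : injective (iter i g).
Proof. by elim: i => // i IH x y /= /endomorphism_inj/IH. Qed.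

Lemma iter_free n (c : 'I_n -> L) :
  (forall i j : 'I_n, iter i g =1 iter j g -> i = j) ->
  (forall x, \sum_(i < n) c i * iter i g x = 0) -> forall i, c i = 0.
Proof.
move=> inj; apply: multiplicative_maps_free => // i; first exact: iter_morph1.
exact: iter_morphM.
Qed.

(** If the iterates of [g] were pairwise distinct, [\dim L + 1] of them would
have linearly dependent value vectors on a basis of [L], against Dedekind. *)
Lemma automorphism_finite_order : finite_order g.
Proof.
apply: contrapT => nfin.
have inj i j : iter i g =1 iter j g -> i = j.
  wlog ij : i j / (i <= j)%N => [H|gij].
    by have [/H//|/ltnW/H ji /fsym/ji] := leqP i j.
  apply: contrapT => nij; apply: nfin; exists (j - i)%N.
  have lij : (i < j)%N by rewrite ltn_neqAle ij andbT; apply/eqP.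
  rewrite subn_gt0 lij; apply/asboolP => x.
  by apply: (@iter_injective i); rewrite -iterD subnKC// -gij.
pose d := \dim (fullv : {vspace L}).
pose b := vbasis (fullv : {vspace L}).
pose M : 'M[L]_(d.+1, d) := \matrix_(i, j) iter i g b`_j.
have /rowV0Pn[c cM c0] : kermx M != 0.
  rewrite -mxrank_eq0 mxrank_ker subn_eq0 -ltnNge.
  by rewrite ltnS rank_leq_col.
move/sub_kermxP: cM => cM; move/eqP: c0; apply; apply/rowP => i; rewrite mxE.
apply: (@iter_free _ (c 0)) => [k l /inj/val_inj//|x].
have /(coord_vbasis) -> : x \in (fullv : {vspace L}) by exact: memvf.
have eM (j : 'I_d) : \sum_(k < d.+1) c 0 k * iter k g b`_j = 0.
  have := congr1 (fun A : 'rV_d => A 0 j) cM; rewrite !mxE => cMj.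
  by rewrite -[RHS]cMj; apply: eq_bigr => k _; rewrite mxE.
transitivity (\sum_(j < d) coord b j x *: \sum_(k < d.+1) c 0 k * iter k g b`_j).
  under eq_bigr => k _ do rewrite iter_sumZ mulr_sumr.
  rewrite exchange_big/=; apply: eq_bigr => j _; rewrite scaler_sumr.
  by apply: eq_bigr => k _; rewrite scalerAr.
by rewrite big1// => j _; rewrite eM scaler0.
Qed.

Lemma iter_ord_inj (i j : nat) : (i < ord g)%N -> (j < ord g)%N ->
  iter i g =1 iter j g -> i = j.
Proof.
wlog ij : i j / (i <= j)%N => [H io jo gij|_ jo gij].
  by have [/H->//|/ltnW/H->//] := leqP i j; move=> x; rewrite gij.
apply/eqP; rewrite eqn_leq ij leqNgt; apply/negP => lij.
have {gij} gji x : iter (j - i) g x = x.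
  by apply: (@iter_injective i); rewrite -iterD subnKC// -gij.
suff : (ord g <= j - i)%N.
  by rewrite leqNgt (leq_ltn_trans _ jo)// leq_subr.
by apply: ord_le => //; rewrite subn_gt0.
Qed.

End field_endomorphism.

(** * Clopen sets in compact totally disconnected spaces *)

(** The clopen sets containing [x] shrink to the quasi-component of [x], so by
compactness of the complement of [W] one of them already lies in [W]. *)
Lemma clopen_quasicomponent_nbhs (X : topologicalType) (x : X) (W : set X) :
  compact [set: X] -> open W ->
  (forall y, (forall C, clopen C -> C x -> C y) -> W y) ->
  exists C, [/\ clopen C, C x & C `<=` W].
Proof.
move=> cX oW QW.
pose F := filter_from [set D : set X | D x /\ clopen D] id.
have FF : Filter F.
  apply: filter_from_filter; first by exists setT; split => //; exact: clopenT.
  by move=> A B [? ?] [? ?]; exists (A `&` B) => //; split=> //; exact: clopenI.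
have PF : ProperFilter F by apply: filter_from_proper; move=> ? [? _]; exists x.
have /(iffLR (compact_near_coveringP _)) : compact (~` W).
  by apply: (subclosed_compact _ cX) => //; exact: open_closedC.
move=> /(_ _ _ setC (powerset_filter_from_filter PF))[].
  move=> y nWy.
  have [C [[oC cC] Cx Cy]] : exists C, [/\ clopen C, C x & ~ C y].
    apply: contrapT => H; apply: nWy; apply: QW => C cC Cx.
    by apply: contrapT => nCy; apply: H; exists C.
  exists (~` C, [set U | U `<=` C]); first split.
  - by apply: open_nbhs_nbhs; split => //; exact: closed_openC.
  - apply/near_powerset_filter_fromP; first by move=> ? ?; exact: subset_trans.
    by exists C => //; exists C.
  - by case=> i j [? /subsetC]; apply.
move=> D [DF _ [C DC]]/(_ _ DC)/subsetC2 CW.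
by have [B [Bx cB] BC] := DF _ DC; exists B; split => //; exact: subset_trans CW.
Qed.

(** In a compact Hausdorff space the quasi-component [Q] of a point is connected,
hence equal to the connected component: normality puts a relatively clopen piece
of [Q] and its complement in [Q] inside disjoint open sets, and a small clopen
set around [Q] splits along them. *)
Lemma compact_totally_disconnected_zero_dimensional (X : topologicalType) :
  hausdorff_space X -> compact [set: X] -> totally_disconnected [set: X] ->
  zero_dimensional X.
Proof.
move=> hX cX tdX x y xy; apply: contrapT => nsep.
pose Q := [set z | forall C, clopen C -> C x -> C z].
have Qx : Q x by [].
have Qy : Q y.
  by move=> C cC Cx; apply: contrapT => nCy; apply: nsep; exists C.
have clQ : closed Q.
  have -> : Q = \bigcap_(C in [set C | clopen C /\ C x]) C.
    by apply/seteqP; split => z H C; [case; exact: H | move=> ? ?; exact: H].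
  by apply: closed_bigI => C [[]].
suff cQ : connected Q.
  have := connected_component_max Qx (@subsetT _ Q) cQ.
  by rewrite tdX// => /(_ _ Qy) /= yx; rewrite yx eqxx in xy.
have nX := compact_normal hX cX.
(* Pass to the complement in [Q] when [B] misses [x]. *)
suff main (B : set X) : B x -> (exists2 C, open C & B = Q `&` C) ->
    (exists2 C, closed C & B = Q `&` C) -> B = Q.
  move=> B [z Bz] oB cB; have [Bx|nBx] := pselect (B x); first exact: main.
  have : Q `\` B = Q.
    apply: main => //.
      case: cB => C cC ->; exists (~` C); first exact: closed_openC.
      by apply/seteqP; split=> t /=; tauto.
    case: oB => C cC ->; exists (~` C); first exact: open_closedC.
    by apply/seteqP; split=> t /=; tauto.
  move=> QB; have Qz : Q z by case: oB => C _ BC; move: Bz; rewrite BC => -[].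
  by move: Qz; rewrite -QB => -[_ /(_ Bz)].
move=> Bx [D oD BD] [K cK BK].
have clB : closed B by rewrite BK; exact: closedI.
have clB' : closed (Q `\` B).
  have -> : Q `\` B = Q `&` ~` D by rewrite BD; apply/seteqP; split=> t /=; tauto.
  by apply: closedI => //; exact: open_closedC.
have [|N BN clN] := nX _ clB (~` (Q `\` B)).
  apply/set_nbhsP; exists (~` (Q `\` B)); split => //; first exact: closed_openC.
  by move=> t Bt [_].
have /set_nbhsP[U [oU BU UN]] := BN.
pose V := ~` closure N.
have oV : open V by apply: closed_openC; exact: closed_closure.
have B'V : Q `\` B `<=` V by move=> t QBt /clN.
have UV t : U t -> ~ V t by move=> /UN Nt; apply; exact: subset_closure.
have [C [[oC cC] Cx CUV]] : exists C, [/\ clopen C, C x & C `<=` U `|` V].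
  apply: clopen_quasicomponent_nbhs => //; first exact: openU.
  move=> z Qz; have [Bz|nBz] := pselect (B z); first by left; exact: BU.
  by right; apply: B'V.
have cCU : clopen (C `&` U).
  split; first exact: openI.
  have -> : C `&` U = C `&` ~` V.
    apply/seteqP; split=> t [Ct].
      by move=> Ut; split => //; exact: UV.
    by move=> nVt; split=> //; case: (CUV _ Ct).
  by apply: closedI => //; exact: open_closedC.
apply/seteqP; split=> z; first by rewrite BD => -[].
move=> Qz; apply: contrapT => nBz.
have [_ Uz] := Qz _ cCU (conj Cx (BU _ Bx)).
exact: (UV _ Uz (B'V _ (conj Qz nBz))).
Qed.

(** * Valuations *)

Section valuation_theory.
Context (R : realType) (F : fieldType) (v : valuation R F).

Lemma valuation0 : v 0 = 0.
Proof. exact/valuation_eq0. Qed.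

Lemma valuation_gt0 a : a != 0 -> 0 < v a.
Proof.
move=> a0; rewrite lt_neqAle valuation_ge0 andbT eq_sym.
by apply: contraNneq a0 => /valuation_eq0 ->.
Qed.

Lemma valuation1 : v 1 = 1.
Proof.
apply: (mulfI (lt0r_neq0 (valuation_gt0 (oner_neq0 F)))).
by rewrite -valuationM !mulr1.
Qed.

Lemma valuationX a n : v (a ^+ n) = v a ^+ n.
Proof. by elim: n => [|n IH]; rewrite ?expr0 ?valuation1// !exprS valuationM IH. Qed.

Lemma valuationV a : v a^-1 = (v a)^-1.
Proof.
have [->|a0] := eqVneq a 0; first by rewrite invr0 valuation0 invr0.
apply: (mulfI (lt0r_neq0 (valuation_gt0 a0))).
by rewrite -valuationM !divff ?valuation1// lt0r_neq0// valuation_gt0.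
Qed.

Lemma valuationN a : v (- a) = v a.
Proof.
apply/eqP; rewrite -(@eqrXn2 _ 2) ?valuation_ge0//.
by rewrite -!valuationX sqrrN.
Qed.

Lemma valuationB a b : v (a - b) <= v a + v b.
Proof. by rewrite -(valuationN b) valuationD. Qed.

Lemma valuation_sum I (r : seq I) (P : pred I) (f : I -> F) :
  v (\sum_(i <- r | P i) f i) <= \sum_(i <- r | P i) v (f i).
Proof.
elim/big_ind2: _ => // [|a b c d ab cd]; first by rewrite valuation0.
by rewrite (le_trans (valuationD _ _ _))// lerD.
Qed.

End valuation_theory.

Lemma bernoulli_ineq (R : realDomainType) (h : R) n :
  0 <= h -> 1 + n%:R * h <= (1 + h) ^+ n.
Proof.
move=> h0; elim: n => [|n IH]; first by rewrite mul0r addr0 expr0.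
rewrite exprS; apply: (@le_trans _ _ ((1 + h) * (1 + n%:R * h))).
  by rewrite -natr1 mulrDl mulrDr !mul1r mulr1; have := ler0n R n; nra.
by rewrite ler_wpM2l// addr_ge0.
Qed.

Lemma exists_nat_gt (R : realType) (x : R) : exists n : nat, x < n%:R.
Proof. by exists (Num.truncn x).+1; exact: truncnS_gt. Qed.

Lemma le1_of_bounded_powers (R : realType) (C r : R) :
  0 <= r -> (forall n, r ^+ n <= C) -> r <= 1.
Proof.
move=> r0 rC; rewrite leNgt; apply/negP => r1.
have [n nC] := exists_nat_gt (C / (r - 1)).
have := rC n; apply/negP; rewrite -ltNge.
have h0 : 0 < r - 1 by rewrite subr_gt0.
rewrite ltr_pdivrMr// in nC.
apply: (lt_le_trans nC); have := bernoulli_ineq n (ltW h0).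
by rewrite [1 + (r - 1)]addrC subrK; apply: le_trans; rewrite lerDr.
Qed.

(** Bernoulli on every third power makes [r ^+ (3 * m)] grow at least like
[m ^+ 3], which beats the quadratic bound; 16 covers [(3 * m + 1) ^+ 2]. *)
Lemma le1_of_quadratic_powers (R : realType) (r : R) :
  0 <= r -> (forall n, r ^+ n <= (n.+1%:R) ^+ 2) -> r <= 1.
Proof.
move=> r0 rC; rewrite leNgt; apply/negP => r1.
have h0 : 0 < r - 1 by rewrite subr_gt0.
have [n nC] := exists_nat_gt (16 / (r - 1) ^+ 3).
rewrite ltr_pdivrMr ?exprn_gt0// in nC.
have := rC (n.+1 * 3)%N; apply/negP; rewrite -ltNge exprM.
have hB := bernoulli_ineq n.+1 (ltW h0).
rewrite [1 + (r - 1)]addrC subrK in hB.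
have m1 : 1 <= n.+1%:R :> R by rewrite ler1n.
set m : R := n.+1%:R in hB m1 *.
have mC : 16 < m * (r - 1) ^+ 3.
  by apply: (lt_le_trans nC); apply: ler_wpM2r;
    [exact/exprn_ge0/ltW|rewrite /m ler_nat].
have mh : 0 <= m * (r - 1) by rewrite mulr_ge0// ltW// (lt_le_trans ltr01).
apply: (@lt_le_trans _ _ ((m * (r - 1)) ^+ 3)); last first.
  by rewrite lerXn2r ?nnegrE ?exprn_ge0//; lra.
rewrite -natr1 natrM -/m exprMn.
apply: (@le_lt_trans _ _ (16 * m ^+ 2)); first by nra.
have -> : m ^+ 3 * (r - 1) ^+ 3 = (m * (r - 1) ^+ 3) * m ^+ 2 by ring.
by rewrite ltr_pM2r// exprn_gt0// (lt_le_trans ltr01).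
Qed.

(** Horner evaluation of the binary expansion of [n] costs one unit for each
binary digit. *)
Lemma valuation_nat_le (R : realType) (F : fieldType) (v : valuation R F) :
  v 2 <= 1 -> forall k n, (n < 2 ^ k)%N -> v n%:R <= k%:R.
Proof.
move=> v2; elim=> [|k IH] n.
  by rewrite expn0 ltnS leqn0 => /eqP->; rewrite valuation0.
rewrite expnS => nk; rewrite -{1}(odd_double_half n) natrD -natr1 addrC.
rewrite (le_trans (valuationD _ _ _))// lerD//.
  rewrite -muln2 natrM valuationM.
  have /IH h : (n./2 < 2 ^ k)%N by rewrite ltn_half_double -mul2n.
  by rewrite -[leRHS]mulr1 ler_pM ?valuation_ge0.
by case: (odd n); rewrite ?valuation1 ?valuation0.
Qed.

(** In the binomial expansion of [(a + b) ^+ n] each coefficient has valuation at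
most [n + 1] by [valuation_nat_le], so [v (a + b) ^+ n <= (n + 1) ^+ 2 * M ^+ n]
with [M] the larger of [v a] and [v b]; now extract [n]th roots. *)
Lemma non_archimedean_of_le1 (R : realType) (F : fieldType) (v : valuation R F) :
  v 2 <= 1 -> non_archimedean v.
Proof.
move=> v2.
suff main a b : v (a + b) <= Num.max (v a) (v b).
  by move=> a b; rewrite -(valuationN v b); exact: main.
set M := Num.max _ _.
have M0 : 0 <= M by rewrite /M le_max valuation_ge0.
have vaM : v a <= M by rewrite /M le_max lexx.
have vbM : v b <= M by rewrite /M le_max lexx orbT.
have [/eqP M00|Mn0] := boolP (M == 0).
  have /valuation_eq0 -> : v a = 0 by apply/le_anti; rewrite valuation_ge0 -M00 vaM.
  have /valuation_eq0 -> : v b = 0 by apply/le_anti; rewrite valuation_ge0 -M00 vbM.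
  by rewrite addr0 valuation0.
have Mp : 0 < M by rewrite lt_neqAle eq_sym Mn0.
suff : v (a + b) / M <= 1 by rewrite ler_pdivrMr// mul1r.
apply: le1_of_quadratic_powers; first by rewrite divr_ge0// valuation_ge0.
move=> n; rewrite exprMn exprVn ler_pdivrMr ?exprn_gt0// -valuationX exprDn.
apply: (le_trans (valuation_sum _ _ _ _)).
apply: (@le_trans _ _ (\sum_(i < n.+1) n.+1%:R * M ^+ n)); last first.
  by rewrite sumr_const card_ord -[leLHS]mulr_natl mulrA expr2.
apply: ler_sum => -[i /=]; rewrite ltnS => ni _.
rewrite -mulr_natl valuationM ler_pM ?valuation_ge0//.
  apply: valuation_nat_le => //; rewrite expnS mul2n -addnn.
  have binle : ('C(n, i) <= 2 ^ n)%N.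
    rewrite -[2%N]/(1 + 1)%N expnDn (bigD1 (Ordinal (ni : (i < n.+1)%N)))//=.
    by rewrite !exp1n !muln1 leq_addr.
  by rewrite (leq_ltn_trans binle)// -[ltnLHS]addn0 ltn_add2l expn_gt0.
rewrite valuationM !valuationX -[in leRHS](subnK ni) exprD.
by rewrite ler_pM ?exprn_ge0 ?valuation_ge0 ?lerXn2r ?nnegrE ?valuation_ge0.
Qed.

(** * Linear maps on a finite extension of a complete field *)

Lemma invS_lt (R : realType) (e : R) : 0 < e ->
  exists N : nat, forall n : nat, (N <= n)%N -> n.+1%:R^-1 < e.
Proof.
move=> e0; have [N eN] := exists_nat_gt e^-1; exists N => n Nn.
rewrite invf_plt ?posrE// (lt_le_trans eN)// ler_nat.
exact: leq_trans (leqnSn _).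
Qed.

Section finite_extension.
Context (R : realType) (F : fieldType) (vF : valuation R F)
  (L : fieldExtType F) (vL : valuation R L).
Hypothesis completeF : complete_valuation vF.
Hypothesis vL_extends : forall a : F, vL (a%:A) = vF a.

Let complete_vspace (U : {vspace L}) :=
  complete_for (vdist vL) [set a | a \in U].

Lemma valuationZ (a : F) x : vL (a *: x) = vF a * vL x.
Proof. by rewrite -mulr_algl valuationM vL_extends. Qed.

(** A complete subspace [U] is closed, so [e] lies at positive distance [d] from
it.  By homogeneity this bounds the coordinate along [e]; the scaling argument
also covers the trivial valuation. *)
Lemma projection_bounded (U : {vspace L}) e : complete_vspace U -> e \notin U ->
  exists2 d : R, 0 < d & forall w a, w \in U -> d * vF a <= vL (w + a *: e).
Proof.
move=> cU eU.
have [d d0 dU] : exists2 d : R, 0 < d & forall w, w \in U -> d <= vL (w + e).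
  apply: contrapT => H.
  have /choice[u uP] (n : nat) : exists w, w \in U /\ vL (w + e) < n.+1%:R^-1.
    apply: contrapT => nw; apply: H; exists n.+1%:R^-1; rewrite ?invr_gt0//.
    by move=> w wU; rewrite leNgt; apply/negP => we; apply: nw; exists w.
  have uU n : u n \in U by have [] := uP n.
  have ue n : vL (u n + e) < n.+1%:R^-1 by have [] := uP n.
  have [|l lU lu] := cU u uU.
    move=> r r0; have [N NP] := invS_lt (divr_gt0 r0 (ltr0n R 2)).
    exists N => m n Nm Nn; rewrite /vdist.
    have -> : u m - u n = (u m + e) - (u n + e) by rewrite opprD addrACA subrr addr0.
    rewrite (le_lt_trans (valuationB _ _ _))// (splitr r).
    by rewrite ltrD// (lt_trans (ue _))// NP.
  suff le0 : l + e = 0 by move: eU; rewrite -[e](addKr l) le0 addr0 memvN lU.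
  apply/(valuation_eq0 vL)/le_anti; rewrite valuation_ge0 andbT.
  apply/ler_addgt0Pl => r r0; rewrite addr0.
  have [N NP] := invS_lt (divr_gt0 r0 (ltr0n R 2)).
  have [M MP] := lu _ (divr_gt0 r0 (ltr0n R 2)).
  pose n := maxn N M.
  have -> : l + e = (u n + e) - (u n - l).
    by ring.
  rewrite (le_trans (valuationB _ _ _))// (splitr r) lerD// ltW//.
    by rewrite (lt_trans (ue _))// NP// leq_maxl.
  by apply: MP; rewrite leq_maxr.
exists d => // w a wU; have [->|a0] := eqVneq a 0.
  by rewrite valuation0 mulr0 valuation_ge0.
have -> : w + a *: e = a *: (a^-1 *: w + e).
  by rewrite scalerDr scalerA divff// scale1r.
rewrite valuationZ mulrC ler_wpM2l ?valuation_ge0//.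
by apply: dU; rewrite memvZ.
Qed.

Lemma complete_vspace0 : complete_vspace 0%VS.
Proof.
move=> u u0 _; exists 0; first exact: mem0v.
move=> e e0; exists 0 => n _; have := u0 n; rewrite /= memv0 => /eqP ->.
by rewrite /vdist subrr valuation0.
Qed.

Lemma complete_vspaceD (U : {vspace L}) e :
  complete_vspace U -> complete_vspace (<[e]> + U)%VS.
Proof.
move=> cU; have [eU|eU] := boolP (e \in U).
  suff -> : (<[e]> + U)%VS = U by [].
  by apply/addv_idPr; rewrite -memvE.
have [d d0 dP] := projection_bounded cU eU.
move=> u uU uC.
have /choice[wa waP] (n : nat) : exists wa : L * F,
    wa.1 \in U /\ u n = wa.1 + wa.2 *: e.
  have /memv_addP[x /vlineP[a ->] [w wU ->]] := uU n.
  by exists (w, a); rewrite addrC.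
pose w n := (wa n).1; pose a n := (wa n).2.
have wU n : w n \in U by have [] := waP n.
have uE n : u n = w n + a n *: e by have [] := waP n.
have uB m n : u m - u n = (w m - w n) + (a m - a n) *: e.
  by rewrite !uE scalerBl opprD addrACA.
have aB m n : vF (a m - a n) <= vL (u m - u n) / d.
  by rewrite ler_pdivlMr// mulrC uB dP// memvB.
have [|a' _ aa'] := @completeF a (fun=> I).
  move=> r r0; have [N NP] := uC _ (mulr_gt0 r0 d0); exists N => m n Nm Nn.
  by rewrite (le_lt_trans (aB _ _))// ltr_pdivrMr// NP.
pose K := 1 + vL e / d.
have K0 : 0 < K by rewrite ltr_pwDl// divr_ge0 ?valuation_ge0// ltW.
have wB m n : vL (w m - w n) <= K * vL (u m - u n).
  have -> : w m - w n = (u m - u n) - (a m - a n) *: e by rewrite uB addrK.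
  rewrite (le_trans (valuationB _ _ _))// mulrDl mul1r lerD2l valuationZ.
  by rewrite mulrAC -mulrA mulrC ler_wpM2l ?valuation_ge0.
have [|w' w'U ww'] := cU w wU.
  move=> r r0; have [N NP] := uC _ (divr_gt0 r0 K0); exists N => m n Nm Nn.
  by rewrite (le_lt_trans (wB _ _))// mulrC -ltr_pdivlMr// NP.
exists (w' + a' *: e) => [|r r0] /=.
  by rewrite addrC memv_add// memvZ// memv_line.
have r2 := divr_gt0 r0 (ltr0n R 2).
have e1 : 0 < 1 + vL e by rewrite ltr_pwDl// valuation_ge0.
have [N NP] := ww' _ r2; have [M MP] := aa' _ (divr_gt0 r2 e1).
exists (maxn N M) => n; rewrite geq_max => /andP[Nn Mn].
have -> : vdist vL (u n) (w' + a' *: e) = vL ((w n - w') + (a n - a') *: e).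
  by rewrite /vdist uE scalerBl opprD addrACA.
rewrite (le_lt_trans (valuationD _ _ _))// (splitr r) ltrD//; first exact: NP.
rewrite valuationZ; have := MP _ Mn; rewrite /vdist ltr_pdivlMr//.
by apply: le_lt_trans; rewrite ler_wpM2l ?valuation_ge0// lerDr.
Qed.

(** Induction on a spanning family: completeness of the span of the vectors
already treated is what bounds the coordinate along the next one. *)
Lemma linear_bounded (f : 'End(L)) :
  exists2 C : R, 0 <= C & forall x, vL (f x) <= C * vL x.
Proof.
suff main (xs : seq L) : complete_vspace <<xs>>%VS /\
    exists2 C : R, 0 <= C & forall x, x \in <<xs>>%VS -> vL (f x) <= C * vL x.
  have [_ [C C0 CP]] := main (vbasis (fullv : {vspace L})).
  by exists C => // x; apply: CP; rewrite (span_basis (vbasisP _)) memvf.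
elim: xs => [|e xs [cU [C C0 CP]]].
  rewrite span_nil; split; first exact: complete_vspace0.
  exists 0 => // x; rewrite memv0 => /eqP ->.
  by rewrite linear0 valuation0 mulr0.
rewrite span_cons; split; first exact: complete_vspaceD.
have [eU|eU] := boolP (e \in <<xs>>%VS).
  suff -> : (<[e]> + <<xs>>)%VS = <<xs>>%VS by exists C.
  by apply/addv_idPr; rewrite -memvE.
have [d d0 dP] := projection_bounded cU eU.
exists (C * (1 + vL e / d) + vL (f e) / d).
  have dge x : 0 <= vL x / d by rewrite divr_ge0 ?valuation_ge0// ltW.
  by rewrite addr_ge0 ?dge// mulr_ge0// addr_ge0 ?dge.
move=> x /memv_addP[y /vlineP[a ->] [w wU ->]].
rewrite [a *: e + w]addrC; set x' := w + _.
have aB : vF a <= vL x' / d by rewrite ler_pdivlMr// mulrC dP.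
have wB : vL w <= (1 + vL e / d) * vL x'.
  have -> : w = x' - a *: e by rewrite addrK.
  rewrite (le_trans (valuationB _ _ _))// mulrDl mul1r lerD2l valuationZ.
  by rewrite mulrAC -mulrA mulrC ler_wpM2l ?valuation_ge0.
rewrite /x' linearD linearZ/= -/x' (le_trans (valuationD _ _ _))// mulrDl lerD//.
  by rewrite (le_trans (CP _ wU))// -mulrA ler_wpM2l.
by rewrite valuationZ mulrAC -mulrA mulrC ler_wpM2l ?valuation_ge0.
Qed.

(** The bound [vL (g x) <= C * vL x] at the powers of [x] gives [C = 1] after
extracting roots, and [x^-1] gives the reverse inequality. *)
Lemma automorphism_isometry (g : 'End(L)) :
  g 1 = 1 -> {morph g : x y / x * y} -> forall x, vL (g x) = vL x.
Proof.
move=> g1 gM; have [C C0 CP] := linear_bounded g.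
have g_le x : vL (g x) <= vL x.
  have [->|x0] := eqVneq x 0; first by rewrite linear0.
  have vx0 := valuation_gt0 vL x0.
  suff : vL (g x) / vL x <= 1 by rewrite ler_pdivrMr// mul1r.
  apply: (@le1_of_bounded_powers _ C); first by rewrite divr_ge0 ?valuation_ge0.
  move=> n; rewrite exprMn exprVn ler_pdivrMr ?exprn_gt0//.
  by rewrite -!valuationX -(endomorphismX g1 gM).
move=> x; have [->|x0] := eqVneq x 0; first by rewrite linear0.
apply/le_anti; rewrite g_le/=.
have gx0 : g x != 0.
  by rewrite -(linear0 g); apply: contra_neq x0 => /(endomorphism_inj g1 gM).
have := g_le x^-1; rewrite (endomorphismV g1 gM) !valuationV.
by rewrite lef_pV2 ?posrE//; exact: valuation_gt0.
Qed.

End finite_extension.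

(** * A path in an Archimedean valued field *)

Section dyadic_path.
Context (R : realType) (L : fieldType) (v : valuation R L).
Hypothesis v2 : 1 < v 2.
Hypothesis completeL : complete_valuation v.

Let q : R := (v 2)^-1.
Let q0 : 0 < q. Proof. by rewrite invr_gt0 (lt_trans ltr01). Qed.
Let q1 : q < 1. Proof. by rewrite invf_lt1// (lt_trans ltr01). Qed.
Let two_neq0 : 2 != 0 :> L.
Proof. by apply: contraTneq v2 => ->; rewrite valuation0 ltr10. Qed.

Lemma exists_expr_lt (e : R) : 0 < e -> exists N : nat, q ^+ N < e.
Proof.
move=> e0; apply: contrapT => H.
have : q^-1 <= 1.
  apply: (@le1_of_bounded_powers _ e^-1); first by rewrite invr_ge0 ltW.
  move=> n; rewrite exprVn lef_pV2 ?posrE ?exprn_gt0// leNgt.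
  by apply/negP => qn; apply: H; exists n.
by rewrite invf_le1// leNgt q1.
Qed.

(** The truncation of the binary expansion of [t] to [n] digits after the point,
read in [L]. *)
Definition dyad (n : nat) (t : R) : L :=
  (Num.floor (2 ^+ n * t))%:~R / 2 ^+ n.

Lemma valuation_int_le1 (m : int) : `|m| <= 1 -> v m%:~R <= 1.
Proof.
rewrite ler_norml => /andP[m1 m2].
have [->|[->|->]] : m = 0 \/ m = 1 \/ m = -1 by lia.
- by rewrite valuation0.
- by rewrite valuation1.
- by rewrite mulrN1z valuationN valuation1.
Qed.

Lemma dyadS n t : v (dyad n.+1 t - dyad n t) <= q ^+ n.+1.
Proof.
rewrite /dyad; set a := Num.floor _; set b := Num.floor _.
have -> : a%:~R / 2 ^+ n.+1 - b%:~R / 2 ^+ n = (a - 2 * b)%:~R / 2 ^+ n.+1 :> L.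
  by rewrite intrB intrM exprS; field; rewrite expf_neq0.
rewrite valuationM valuationV valuationX -exprVn ler_piMl ?exprn_ge0 ?(ltW q0)//.
apply: valuation_int_le1.
have := floor_itv (2 ^+ n.+1 * t); have := floor_itv (2 ^+ n * t).
rewrite -/a -/b exprS !intrD/= => /andP[b1 b2] /andP[a1 a2].
have : (2 * b)%:~R < (a + 1)%:~R :> R by rewrite intrM intrD; lra.
have : a%:~R < (2 * b + 2)%:~R :> R by rewrite intrD intrM; lra.
rewrite !ltr_int ler_norml => ? ?; lia.
Qed.

(** Points at distance at most [2 ^- n] have the same or adjacent truncations. *)
Lemma dyad_near n t s :
  `|t - s| * 2 ^+ n <= 1 -> v (dyad n t - dyad n s) <= q ^+ n.
Proof.
rewrite /dyad; set a := Num.floor _; set b := Num.floor _ => ts.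
rewrite -mulrBl -intrB valuationM valuationV valuationX -exprVn.
rewrite ler_piMl ?exprn_ge0 ?(ltW q0)//.
apply: valuation_int_le1.
have := floor_itv (2 ^+ n * t); have := floor_itv (2 ^+ n * s).
rewrite -/a -/b !intrD/= => /andP[b1 b2] /andP[a1 a2].
have p0 : 0 <= 2 ^+ n :> R by rewrite exprn_ge0.
have : `|2 ^+ n * t - 2 ^+ n * s| <= 1.
  by rewrite -mulrBr normrM mulrC (ger0_norm p0).
rewrite ler_norml => /andP[ts1 ts2].
have : a%:~R < (b + 2)%:~R :> R by rewrite intrD; lra.
have : b%:~R < (a + 2)%:~R :> R by rewrite intrD; lra.
rewrite !ltr_int ler_norml => ? ?; lia.
Qed.

Let C : R := (1 - q)^-1.
Let C0 : 0 < C. Proof. by rewrite invr_gt0 subr_gt0. Qed.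

Lemma dyadD n k t : v (dyad (n + k) t - dyad n t) <= C * q ^+ n.
Proof.
suff : v (dyad (n + k) t - dyad n t) <= C * (q ^+ n.+1 - q ^+ (n + k).+1).
  move=> /le_trans; apply; rewrite ler_wpM2l ?(ltW C0)// exprS.
  rewrite lerBlDr (@le_trans _ _ (q ^+ n))//; last by rewrite lerDl exprn_ge0 ?(ltW q0).
  by rewrite ler_piMl ?exprn_ge0 ?(ltW q0) ?(ltW q1).
elim: k => [|k IH]; first by rewrite addn0 !subrr valuation0 mulr0.
rewrite addnS -(subrKA (dyad (n + k) t)) (le_trans (valuationD _ _ _))//.
rewrite (le_trans (lerD (dyadS _ _) IH))// -subr_ge0.
rewrite le_eqVlt; apply/orP; left; rewrite eq_sym; apply/eqP.
rewrite /C (exprS q (n + k).+1); field.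
by rewrite subr_eq0 gt_eqF.
Qed.

(** Consecutive truncations differ by at most a power of [(v 2)^-1 < 1], so they
converge uniformly; the limit inherits uniform continuity from
[dyad_near]. *)
Lemma nonconstant_path : exists phi : R -> L, [/\ phi 0 = 0, phi 1 = 1 &
  forall e : R, 0 < e -> exists2 d : R, 0 < d &
    forall t s, `|t - s| < d -> v (phi t - phi s) < e].
Proof.
have /choice[phi phiP] (t : R) : exists l, forall e, 0 < e ->
    exists N : nat, forall n : nat, (N <= n)%N -> v (dyad n t - l) < e.
  have [|l _ lP] := @completeL (dyad^~ t) (fun=> I); last by exists l.
  move=> e e0; have [N NP] := exists_expr_lt (divr_gt0 (divr_gt0 e0 (ltr0n R 2)) C0).
  rewrite ltr_pdivlMr// mulrC in NP.
  exists N => m n Nm Nn; rewrite /vdist.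
  have -> : dyad m t - dyad n t =
      (dyad m t - dyad N t) - (dyad n t - dyad N t) by ring.
  rewrite (le_lt_trans (valuationB _ _ _))// (splitr e) ltrD//.
    by rewrite -(subnKC Nm) (le_lt_trans (dyadD _ _ _)).
  by rewrite -(subnKC Nn) (le_lt_trans (dyadD _ _ _)).
have lim_eq t a : (forall n, dyad n t = a) -> phi t = a.
  move=> ta; apply/eqP; rewrite -subr_eq0; apply/eqP/(valuation_eq0 v)/le_anti.
  rewrite valuation_ge0 andbT; apply/ler_addgt0Pl => e e0; rewrite addr0.
  have [N /(_ N (leqnn N))] := phiP t e e0; rewrite ta -valuationN opprB.
  exact: ltW.
have phiE n t : v (phi t - dyad n t) <= C * q ^+ n.
  apply/ler_addgt0Pl => e e0; have [N /(_ (n + N)%N (leq_addl _ _)) NP] := phiP t e e0.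
  rewrite -(subrKA (dyad (n + N) t)) (le_trans (valuationD _ _ _))//.
  by rewrite lerD ?dyadD// -valuationN opprB ltW.
exists phi; split.
- by apply: lim_eq => n; rewrite /dyad mulr0 floor0 mul0r.
- apply: lim_eq => n; rewrite /dyad mulr1.
  have -> : 2 ^+ n = (2 ^+ n : int)%:~R :> R by rewrite rmorphXn.
  by rewrite intrKfloor rmorphXn/= divff// expf_neq0.
move=> e e0.
have K0 : 0 < C + 1 + C by rewrite !addr_gt0.
have [N NP] := exists_expr_lt (divr_gt0 e0 K0).
rewrite ltr_pdivlMr// mulrC in NP.
exists (2 ^+ N)^-1; first by rewrite invr_gt0 exprn_gt0.
move=> t s ts; apply: le_lt_trans NP.
have -> : phi t - phi s =
    (phi t - dyad N t) + (dyad N t - dyad N s) - (phi s - dyad N s).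
  by ring.
rewrite (le_trans (valuationB _ _ _))// !mulrDl mul1r lerD//.
rewrite (le_trans (valuationD _ _ _))// lerD// dyad_near//.
by rewrite -ler_pdivlMr ?exprn_gt0// div1r ltW.
Qed.

End dyadic_path.

(** * Continuous functions with values in a valued field *)

Section continuous_functions.
Context (R : realType) (L : fieldType) (v : valuation R L) (X : topologicalType).
Implicit Types f h : X -> L.

Lemma CL_epsP f : CL v f <->
  forall x (e : R), 0 < e -> \forall y \near x, v (f x - f y) < e.
Proof.
split => [cf x e e0|cf x].
  have /cvg_ballP/(_ e e0) := cf x.
  by apply: filterS => y; rewrite ballEmdist.
by apply/cvg_ballP => e e0; near do rewrite ballEmdist/=; exact: cf.
Unshelve. all: by end_near. Qed.

Lemma CL_cst a : CL v (fun _ : X => a).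
Proof. by apply/CL_epsP => x e e0; near=> y; rewrite subrr valuation0.
Unshelve. all: by end_near. Qed.

Lemma CLD f h : CL v f -> CL v h -> CL v (fun x => f x + h x).
Proof.
move=> /CL_epsP cf /CL_epsP ch; apply/CL_epsP => x e e0.
have e2 := divr_gt0 e0 (ltr0n R 2); near=> y.
have -> : f x + h x - (f y + h y) = (f x - f y) + (h x - h y) by ring.
rewrite (le_lt_trans (valuationD _ _ _))// (splitr e) ltrD//.
  by near: y; exact: cf.
by near: y; exact: ch.
Unshelve. all: by end_near. Qed.

Lemma CLM f h : CL v f -> CL v h -> CL v (fun x => f x * h x).
Proof.
move=> /CL_epsP cf /CL_epsP ch; apply/CL_epsP => x e e0.
have e2 := divr_gt0 e0 (ltr0n R 2).
have f1 : 0 < 1 + v (f x) by rewrite ltr_pwDl// valuation_ge0.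
have h1 : 0 < 1 + v (h x) by rewrite ltr_pwDl// valuation_ge0.
near=> y.
have -> : f x * h x - f y * h y = (h x - h y) * f x + (f x - f y) * h y by ring.
rewrite (le_lt_trans (valuationD _ _ _))// (splitr e) !valuationM ltrD//.
  have : v (h x - h y) < e / 2 / (1 + v (f x)).
    by near: y; apply: ch; exact: divr_gt0.
  rewrite ltr_pdivlMr//; apply: le_lt_trans.
  by rewrite ler_wpM2l ?valuation_ge0// lerDr.
have : v (f x - f y) < e / 2 / (1 + v (h x)).
  by near: y; apply: cf; exact: divr_gt0.
rewrite ltr_pdivlMr//; apply: le_lt_trans.
rewrite ler_wpM2l ?valuation_ge0//.
have -> : h y = - (h x - h y) + h x by ring.
rewrite (le_trans (valuationD _ _ _))// lerD2r valuationN ltW//.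
by near: y; exact: ch.
Unshelve. all: by end_near. Qed.

Lemma CL_sum n (f : 'I_n -> X -> L) : (forall i, CL v (f i)) ->
  CL v (fun x => \sum_i f i x).
Proof.
move=> cf; elim: n f cf => [|n IH] f cf.
  rewrite (_ : (fun _ => _) = fun=> 0); first exact: CL_cst.
  by apply/funext => x; rewrite big_ord0.
rewrite (_ : (fun _ => _) = fun x => f ord0 x + \sum_i f (lift ord0 i) x).
  by apply: CLD => //; exact: IH.
by apply/funext => x; rewrite big_ord_recl.
Qed.

Lemma CL_isometry (g : L -> L) f : (forall a b, v (g a - g b) = v (a - b)) ->
  CL v f -> CL v (g \o f).
Proof.
move=> vg /CL_epsP cf; apply/CL_epsP => x e e0; near=> y.
by rewrite /= vg; near: y; exact: cf.
Unshelve. all: by end_near. Qed.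

Lemma CL_comp f (tau : X -> X) : continuous tau -> CL v f -> CL v (f \o tau).
Proof. by move=> ct cf x; apply: continuous_comp; [exact: ct|exact: cf]. Qed.

Lemma CL_uniform_limit (u : nat -> X -> L) f : (forall n, CL v (u n)) ->
  (forall e : R, 0 < e -> exists n, forall x, v (u n x - f x) < e) -> CL v f.
Proof.
move=> cu uf; apply/CL_epsP => x e e0.
have e3 : 0 < e / 3 by rewrite divr_gt0.
have [n nP] := uf _ e3; near=> y.
have -> : f x - f y = (u n x - u n y) - (u n x - f x) + (u n y - f y) by ring.
have -> : e = e / 3 + e / 3 + e / 3 by field.
rewrite (le_lt_trans (valuationD _ _ _))// ltrD//.
rewrite (le_lt_trans (valuationB _ _ _))// ltrD//.
by near: y; move/CL_epsP: (cu n); exact.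
Unshelve. all: by end_near. Qed.

Hypothesis X_compact : compact [set: X].

Lemma CL_bounded f : CL v f -> exists M : R, forall x, v (f x) <= M.
Proof.
move=> /CL_epsP cf.
have cvf : continuous (fun x => v (f x) : R^o).
  move=> x; apply/cvgrPdist_lt => e e0; near=> y.
  have : v (f x - f y) < e by near: y; exact: cf.
  apply: le_lt_trans; rewrite ler_norml.
  have := valuationD v (f x - f y) (f y); rewrite subrK.
  have := valuationD v (f y - f x) (f x); rewrite subrK.
  by rewrite -(valuationN _ (f y - f x)) opprB; lra.
have /compact_bounded[M [_ MP]] :=
  continuous_compact (continuous_subspaceT cvf) X_compact.
exists (M + 1) => x; have := MP (M + 1); rewrite ltrDl ltr01 => /(_ isT (v (f x))).
by move=> /(_ _)vM; apply: le_trans (ler_norm _) (vM _); exists x.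
Unshelve. all: by end_near. Qed.

Lemma le_supdist f h x : CL v f -> CL v h -> v (f x - h x) <= supdist v f h.
Proof.
move=> cf ch; have cfh : CL v (fun x => f x + (-1) * h x).
  by apply: CLD => //; apply: CLM => //; exact: CL_cst.
have [M MP] := CL_bounded cfh.
apply: ub_le_sup; last by exists x.
by exists M => _ [y _ <-]; have := MP y; rewrite mulN1r.
Qed.

Lemma supdist_le f h e : [set: X] !=set0 -> (forall x, v (f x - h x) <= e) ->
  supdist v f h <= e.
Proof.
move=> [x _] fhe; apply: ge_sup; first by exists (v (f x - h x)), x.
by move=> _ [y _ <-].
Qed.

End continuous_functions.

(** * Separating points of a compact space *)

Section separation.
Context (R : realType) (L : fieldType) (v : valuation R L) (X : topologicalType).

Lemma CL_indicator (U : set X) : clopen U ->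
  CL v (fun x : X => if `[< U x >] then 1 else 0).
Proof.
move=> [oU cU]; apply/CL_epsP => x e e0; have [Ux|nUx] := pselect (U x).
  have : \forall y \near x, U y by exact: open_nbhs_nbhs.
  by apply: filterS => y Uy; rewrite !asboolT// subrr valuation0.
have : \forall y \near x, (~` U) y.
  by apply: open_nbhs_nbhs; split => //; exact: closed_openC.
by apply: filterS => y nUy; rewrite !asboolF// subrr valuation0.
Qed.

Hypothesis X_compact : compact [set: X].
Hypothesis X_hausdorff : hausdorff_space X.
Hypothesis completeL : complete_valuation v.
Hypothesis dichotomy : totally_disconnected [set: X] \/ 1 < v 2.

Lemma CL_separates_points (x y : X) : x != y ->
  exists2 h : X -> L, CL v h & h x = 1 /\ h y = 0.
Proof.
move=> xy; case: dichotomy => [tdX|v2].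
  have [U [cU Ux nUy]] :=
    compact_totally_disconnected_zero_dimensional X_hausdorff X_compact tdX xy.
  exists (fun x => if `[< U x >] then 1 else 0); first exact: CL_indicator.
  by rewrite asboolT// asboolF.
have [phi [phi0 phi1 phiC]] := nonconstant_path v2 completeL.
have cl1 (z : X) : closed [set z].
  exact/accessible_closed_set1/hausdorff_accessible.
have yx0 : [set y] `&` [set x] = set0.
  by rewrite -subset0 => z [-> yx]; rewrite yx eqxx in xy.
have /(@uniform_separatorP _ R)[f [cf _ f0 f1]] :=
  normal_uniform_separator (compact_normal X_hausdorff X_compact)
    (cl1 y) (cl1 x) yx0.
have fy : f y = 0 by apply: f0; exists y.
have fx : f x = 1 by apply: f1; exists x.
exists (phi \o f); last by rewrite /= fx fy.
apply/CL_epsP => z e e0; have [d d0 dP] := phiC _ e0; near=> t.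
by apply: dP; near: t; have /cvgrPdist_lt := cf z; exact.
Unshelve. all: by end_near. Qed.

(** A product of functions that separate [x] from each point of [s]. *)
Lemma CL_separates_seq (x : X) (s : seq X) : x \notin s ->
  exists2 h : X -> L, CL v h & h x = 1 /\ forall y, y \in s -> h y = 0.
Proof.
elim: s => [|y s IH]; first by exists (fun=> 1); first exact: CL_cst.
rewrite inE negb_or => /andP[xy /IH[h ch [hx hs]]].
have [k ck [kx ky]] := CL_separates_points xy.
exists (fun x => h x * k x); first exact: CLM.
split=> [|z]; first by rewrite hx kx mulr1.
by rewrite inE => /predU1P[->|/hs->]; rewrite ?ky ?mulr0 ?mul0r.
Qed.

End separation.

(** * Basic function algebras *)

Section basic_algebra_theory.
Context (R : realType) (F : fieldType) (L : fieldExtType F)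
  (v : valuation R L) (X : topologicalType) (tau : X -> X) (g : 'End(L)).
Hypothesis completeL : complete_valuation v.
Hypothesis X_compact : compact [set: X].
Hypothesis tau_continuous : continuous tau.
Hypothesis g1 : g 1 = 1.
Hypothesis gM : {morph g : x y / x * y}.
Hypothesis vg : forall x, v (g x) = v x.

(** With constant [u = u'] this says that fixed points of [g] are closed under
limits; with the values of a sequence of functions at [x] and [tau x], that
equivariance is. *)
Lemma limit_equivariant (u u' : nat -> L) l l' : (forall n, u' n = g (u n)) ->
  (forall e : R, 0 < e -> exists n, v (u n - l) < e /\ v (u' n - l') < e) ->
  l' = g l.
Proof.
move=> uu' ul; apply/eqP; rewrite -subr_eq0; apply/eqP/(valuation_eq0 v)/le_anti.
rewrite valuation_ge0 andbT; apply/ler_addgt0Pl => e e0; rewrite addr0.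
have [n [nl nl']] := ul _ (divr_gt0 e0 (ltr0n R 2)).
have -> : l' - g l = g (u n - l) - (u' n - l').
  by rewrite linearB/= uu'; ring.
by rewrite (le_trans (valuationB _ _ _))// vg (splitr e) lerD// ltW.
Qed.

Lemma fixed_field_complete :
  complete_valued_subfield v [set a : L | a \in fixedSpace g].
Proof.
have fixE (a : L) :
    (a \in mem [set a : L | a \in fixedSpace g]) = (a \in fixedSpace g).
  by apply/idP/idP => [/set_mem|/mem_set].
split.
  split=> [|x y|x y]; rewrite ?fixE; first exact/fixedSpaceP.
    exact: memvB.
  move=> /fixedSpaceP gx /fixedSpaceP gy; apply/fixedSpaceP.
  by rewrite gM (endomorphismV g1 gM) gx gy.
move=> u uK uC; have [|l _ lP] := @completeL u (fun=> I); first exact: uC.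
exists l => //=; apply/fixedSpaceP/esym.
apply: (@limit_equivariant u u) => [n|e e0].
  by apply/esym/fixedSpaceP; exact: uK.
by have [N NP] := lP e e0; exists N; split; exact: NP.
Qed.

Lemma basic_algebra_pointwise :
  is_pointwise_algebra [set a : L | a \in fixedSpace g] (basic_algebra v tau g).
Proof.
split.
- by split; [exact: CL_cst | move=> x; rewrite linear0].
- move=> f h [cf ef] [ch eh]; split; first exact: CLD.
  by move=> x; rewrite ef eh linearD.
- move=> f h [cf ef] [ch eh]; split; first exact: CLM.
  by move=> x; rewrite ef eh gM.
move=> k f /fixedSpaceP gk [cf ef]; split; first by apply: CLM => //; exact: CL_cst.
by move=> x; rewrite ef gM gk.
Qed.

Lemma basic_algebra_complete : [set: X] !=set0 ->
  complete_for (supdist v (X := X)) (basic_algebra v tau g).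
Proof.
move=> X0 u uA uC.
have cu n : CL v (u n) by have [] := uA n.
have u_lt x m n e : supdist v (u m) (u n) < e -> v (u m x - u n x) < e.
  by apply: le_lt_trans; exact: le_supdist.
have /choice[f fP] (x : X) : exists l, forall e : R, 0 < e ->
    exists N : nat, forall n, (N <= n)%N -> v (u n x - l) < e.
  have [|l _ lP] := @completeL (u^~ x) (fun=> I); last by exists l.
  move=> e e0; have [N NP] := uC e e0; exists N => m n Nm Nn.
  exact/u_lt/NP.
have uf (e : R) : 0 < e -> exists N : nat, forall n, (N <= n)%N ->
    forall x, v (u n x - f x) <= e.
  move=> e0; have [N NP] := uC e e0; exists N => n Nn x.
  apply/ler_addgt0Pl => r r0; have [M MP] := fP x r r0.
  have -> : u n x - f x = (u (maxn N M) x - f x) + (u n x - u (maxn N M) x) by ring.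
  rewrite (le_trans (valuationD _ _ _))// lerD//.
    by rewrite ltW// MP// leq_maxr.
  by apply/ltW/u_lt/NP => //; rewrite leq_maxl.
exists f.
  split=> [|x].
    apply: (CL_uniform_limit cu) => e e0.
    have [N /(_ N (leqnn N)) NP] := uf _ (divr_gt0 e0 (ltr0n R 2)).
    exists N => x; rewrite (le_lt_trans (NP x))// ltr_pdivrMr//.
    by rewrite mulr_natr mulr2n ltrDl.
  apply: (@limit_equivariant (fun n => u n x) (fun n => u n (tau x))) => [n|e e0].
    by have [_] := uA n; exact.
  have [N NP] := fP x e e0; have [M MP] := fP (tau x) e e0.
  by exists (maxn N M); rewrite NP ?MP ?leq_maxl ?leq_maxr.
move=> e e0; have [N NP] := uf _ (divr_gt0 e0 (ltr0n R 2)).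
exists N => n Nn; apply: (@le_lt_trans _ _ (e / 2)).
  by apply: supdist_le => // x; exact: NP.
by rewrite ltr_pdivrMr// mulr_natr mulr2n ltrDl.
Qed.

(** The average of [h] over the cyclic group generated by
[h |-> g \o h \o tau^-1]; inverse powers of [tau] are written as positive ones
by means of [tau^N = id]. *)
Definition equivariant_sum (h : X -> L) (x : X) : L :=
  \sum_(j < ord g) iter j g (h (iter (ord g - j) tau x)).

Hypothesis tau_finite : finite_order tau.
Hypothesis ord_dvd : (ord tau %| ord g)%N.

Lemma iter_tau_ord x : iter (ord g) tau x = x.
Proof.
have /dvdnP[k ->] := ord_dvd.
by elim: k => // k IH; rewrite mulSn iterD IH iter_ord.
Qed.

(** Applying [g] shifts the index of summation by one, and the two boundary terms
agree because both [g] and [tau] have trivial [N]th iterate. *)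
Lemma equivariant_sum_basic h : CL v h -> basic_algebra v tau g (equivariant_sum h).
Proof.
move=> ch; split.
  apply: CL_sum => j.
  have cti k : CL v (h \o iter k tau).
    elim: k => // k IH; have := CL_comp tau_continuous IH.
    rewrite (_ : _ \o _ = h \o iter k.+1 tau)//.
    by apply/funext => x /=; rewrite -iterSr.
  move: (ord g - j)%N => k; elim: (nat_of_ord j) => [|i IH]; first exact: cti.
  by apply: CL_isometry IH => a b; rewrite -linearB vg.
move=> x; set N := ord g.
pose G j := iter j g (h (iter (N.+1 - j) tau x)).
have GE : \sum_(j < N) G j.+1 = \sum_(j < N) G j.
  apply: (@addrI _ (G 0%N)); rewrite -[LHS](big_ord_recl N G) big_ord_recr/= addrC.
  congr (_ + _); rewrite /G subn0 subSnn [iter N.+1 tau x]/= iter_tau_ord.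
  by rewrite iter_ord//; exact: automorphism_finite_order.
transitivity (\sum_(j < N) G j).
  apply: eq_bigr => j _; rewrite /G -iterSr subSn//.
  exact: ltnW.
by rewrite -GE /equivariant_sum linear_sum; apply: eq_bigr => j _; rewrite /G subSS.
Qed.

Hypothesis X_hausdorff : hausdorff_space X.
Hypothesis dichotomy : totally_disconnected [set: X] \/ 1 < v 2.

(** Equal values at [x1] and [x2] of the averages of all [a * h] would relate the
powers of [g] linearly; in this relation [g^0] has coefficient
[h x1 - h x2 = 1]. *)
Lemma basic_algebra_separates (x1 x2 : X) : x1 <> x2 ->
  exists2 f, basic_algebra v tau g f & f x1 <> f x2.
Proof.
move=> /eqP x12; apply: contrapT => nsep.
have sep f : basic_algebra v tau g f -> f x1 = f x2.
  by move=> fA; apply: contrapT => fx; apply: nsep; exists f.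
pose o x := [seq iter i tau x | i <- iota 0 (ord g).+1].
pose s := [seq y <- o x1 ++ o x2 | y != x1].
have xs : x1 \notin s by rewrite mem_filter eqxx.
have [h ch [hx hs]] :=
  CL_separates_seq X_compact X_hausdorff completeL dichotomy xs.
have o_mem x i : (i <= ord g)%N -> iter i tau x \in o x.
  by move=> iN; apply/mapP; exists i => //; rewrite mem_iota.
have hE x j : x \in [:: x1; x2] ->
    h (iter (ord g - j) tau x) = (iter (ord g - j) tau x == x1)%:R.
  move=> xx; case: eqVneq => [->//|nx]; apply: hs.
  move: xx; rewrite !inE mem_filter nx mem_cat.
  by move=> /orP[]/eqP->; rewrite o_mem ?leq_subr ?orbT.
pose c x (j : 'I_(ord g)) : L := (iter (ord g - j) tau x == x1)%:R.
have sumE x a : x \in [:: x1; x2] ->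
    equivariant_sum (fun y => a * h y) x = \sum_j c x j * iter j g a.
  move=> xx; apply: eq_bigr => j _; rewrite hE// iter_morphM// mulrC /c.
  case: eqP => _; first by rewrite iter_morph1.
  congr (_ * _); by elim: (nat_of_ord j) => //= i ->; rewrite linear0.
have fin := automorphism_finite_order g1 gM.
have N0 : (0 < ord g)%N by exact: ord_gt0.
(* If no function separates, the coefficients of [g^j] at [x1] and [x2] agree. *)
have c0 : forall j, c x1 j - c x2 j = 0.
  apply: (@iter_free _ _ g) => // [i j /iter_ord_inj ij|a].
    by apply/val_inj/ij.
  under eq_bigr do rewrite mulrBl.
  rewrite sumrB -!sumE ?inE ?eqxx ?orbT//; apply/eqP; rewrite subr_eq0; apply/eqP.
  apply: sep; apply: equivariant_sum_basic; apply: CLM => //; exact: CL_cst.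
have := c0 (Ordinal N0); rewrite /c /= subn0 !iter_tau_ord eqxx.
rewrite eq_sym (negPf x12) subr0 => /eqP; by rewrite oner_eq0.
Qed.

End basic_algebra_theory.

Unset Implicit Arguments.
Set Strict Implicit.

Theorem theorem5p2p1 (R : realType)
    (F : fieldType) (vF : valuation R F)
    (L : fieldExtType F) (vL : valuation R L)
    (completeF : complete_valuation vF) (completeL : complete_valuation vL)
    (vL_extends : forall a : F, vL (a%:A) = vF a)
    (X : topologicalType) (X_nonempty : [set: X] !=set0)
    (X_compact : compact [set: X]) (X_hausdorff : hausdorff_space X)
    (X_disconnected : non_archimedean vF -> totally_disconnected [set: X])
    (g : 'End(L)) (gGal : kAut 1%VS fullv g)
    (tau : X -> X) (tau_continuous : continuous tau)
    (tau_finite : finite_order tau) (ord_dvd : (ord tau %| ord g)%N) :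
  uniform_algebra vL [set a : L | a \in fixedSpace g]
    (basic_algebra vL tau g).
Proof.
have [gM g1] : {morph g : x y / x * y} /\ g 1 = 1.
  move: gGal => /andP[/kHom_monoid_morphism[]]; by split.
have vg := automorphism_isometry completeF vL_extends g1 gM.
(* An Archimedean [F] enters only through the inequality [1 < vF 2]. *)
have dichotomy : totally_disconnected [set: X] \/ 1 < vL 2.
  have [v2|v2] := leP (vF 2) 1; [left|right].
    exact/X_disconnected/non_archimedean_of_le1.
  by have := vL_extends 2; rewrite scaler_nat => ->.
split.
- exact: fixed_field_complete.
- by move=> f [].
- exact: basic_algebra_pointwise.
- exact: basic_algebra_complete.
- by move=> k /fixedSpaceP gk; split => //; exact: CL_cst.
- exact: basic_algebra_separates.
Qed.
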